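(* Let $n\ge 1$. The pure braid group $P_n$ admits a group presentation with generators the right pure braid generators $A_{lm}$, $1\le l<m\le n$, and defining relations (all indices in $\{1,\dots,n\}$): $$\begin{array}{lrcll} P_1) & A_{ij}A_{rs} & = & A_{rs}A_{ij} & \text{for } i<r<s<j \text{ and for } i<j<r<s,\\ P_2) & A_{ir}(A_{is}A_{rs}) & = & (A_{is}A_{rs})A_{ir} & \text{for } i<r<s,\\ P_3) & A_{rs}(A_{ir}A_{is}) & = & (A_{ir}A_{is})A_{rs} & \text{for } i<r<s,\\ P_4) & (A_{rj}A_{rs}A_{rj}^{-1})A_{ij} & = & A_{ij}(A_{rj}A_{rs}A_{rj}^{-1}) & \text{for } i<r<j<s. \end{array}$$
   Context: $B_n$ is the Artin braid group with generators $\sigma_1,\dots,\sigma_{n-1}$ and relations $\sigma_i\sigma_j=\sigma_j\sigma_i$ for $|i-j|>1$ and $\sigma_i\sigma_{i+1}\sigma_i=\sigma_{i+1}\sigma_i\sigma_{i+1}$ for $1\le i\le n-2$. $P_n$ is the kernel of the surjection $B_n\to S_n$ onto the symmetric group sending $\sigma_i$ to the transposition $(i\ i+1)$. The right pure braid generators are the elements of $P_n$ $$A_{ij}=\sigma_i^{-1}\sigma_{i+1}^{-1}\cdots\sigma_{j-2}^{-1}\,\sigma_{j-1}^2\,\sigma_{j-2}\cdots\sigma_{i+1}\sigma_i,\qquad 1\le i<j\le n$$ (so $A_{i,i+1}=\sigma_i^2$). *)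

(* Defs.v *)
From HB Require Import structures.
From mathcomp Require Import all_boot all_fingroup.
From mathcomp Require Import generic_quotient boolp zify.

Set Implicit Arguments.
Unset Strict Implicit.
Unset Printing Implicit Defensive.

Local Open Scope quotient_scope.
Local Open Scope group_scope.

Local Notation repr := generic_quotient.repr.

(* A group word over X; the letter (x, false) stands for x and (x, true) for
   the formal inverse of x. *)
Notation gword X := (seq (X * bool)).

Definition ltr (X : Type) (x : X) : X * bool := (x, false).
Definition ltrV (X : Type) (x : X) : X * bool := (x, true).

(* The congruence on words whose classes form the group < X | u = v, R u v >. *)
Inductive gword_eq (X : Type) (R : gword X -> gword X -> Prop) :
    gword X -> gword X -> Prop :=
| gword_rel u v : R u v -> gword_eq R u v
| gword_cancel x b : gword_eq R [:: (x, b); (x, ~~ b)] [::]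
| gword_refl u : gword_eq R u u
| gword_sym u v : gword_eq R u v -> gword_eq R v u
| gword_trans u v w : gword_eq R u v -> gword_eq R v w -> gword_eq R u w
| gword_cat u u' v v' :
    gword_eq R u u' -> gword_eq R v v' -> gword_eq R (u ++ v) (u' ++ v').

Section PresentedGroup.
Variables (X : choiceType) (R : gword X -> gword X -> Prop).

Definition gword_eqb : rel (gword X) := fun u v => `[< gword_eq R u v >].

Lemma gword_eqb_refl : reflexive gword_eqb.
Proof. by move=> u; apply/asboolP; exact: gword_refl. Qed.

Lemma gword_eqb_sym : symmetric gword_eqb.
Proof. by move=> u v; apply/asboolP/asboolP => /gword_sym. Qed.

Lemma gword_eqb_trans : transitive gword_eqb.
Proof.
move=> v u w /asboolP uv /asboolP vw; apply/asboolP; exact: gword_trans uv vw.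
Qed.

Canonical gword_equiv :=
  EquivRel gword_eqb gword_eqb_refl gword_eqb_sym gword_eqb_trans.

Definition presented := {eq_quot gword_equiv}.
HB.instance Definition _ := Choice.on presented.

Definition pclass (u : gword X) : presented := \pi_{eq_quot gword_equiv} u.

Lemma pclassP u v : pclass u = pclass v <-> gword_eq R u v.
Proof.
by split=> [/(eqmodP gword_equiv)/asboolP|uv];
  [|apply/(eqmodP gword_equiv)/asboolP].
Qed.

Lemma pclassK (a : presented) : pclass (repr a) = a.
Proof. exact: reprK. Qed.

Lemma pclass_ind (P : presented -> Prop) :
  (forall u, P (pclass u)) -> forall a, P a.
Proof. by move=> Pu a; rewrite -[a]pclassK. Qed.

Lemma repr_pclass u : gword_eq R (repr (pclass u)) u.
Proof. by apply/pclassP; rewrite pclassK. Qed.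

Definition gword_inv (u : gword X) : gword X :=
  rev [seq (l.1, ~~ l.2) | l <- u].

Lemma gword_invK : involutive gword_inv.
Proof.
move=> u; rewrite /gword_inv map_rev revK -map_comp -[RHS]map_id.
by apply: eq_map => -[x b] /=; rewrite negbK.
Qed.

Lemma gword_mulwV u : gword_eq R (u ++ gword_inv u) [::].
Proof.
elim: u => [|[x b] u IHu]; first exact: gword_refl.
have -> : gword_inv ((x, b) :: u) = gword_inv u ++ [:: (x, ~~ b)].
  by rewrite /gword_inv /= rev_cons cats1.
apply: (gword_trans _ (gword_cancel R x b)).
have := gword_cat (gword_cat (gword_refl R [:: (x, b)]) IHu)
                  (gword_refl R [:: (x, ~~ b)]).
by rewrite /= -!catA /=.
Qed.

Lemma gword_mulVw u : gword_eq R (gword_inv u ++ u) [::].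
Proof. by have := gword_mulwV (gword_inv u); rewrite gword_invK. Qed.

Lemma gword_inv_congr u v :
  gword_eq R u v -> gword_eq R (gword_inv u) (gword_inv v).
Proof.
move=> uv.
apply: (@gword_trans _ _ _ (gword_inv u ++ (v ++ gword_inv v))).
  rewrite -[X in gword_eq _ X _]cats0; apply: gword_cat; first exact: gword_refl.
  exact/gword_sym/gword_mulwV.
rewrite catA -[X in gword_eq _ _ X]cat0s.
apply: gword_cat; last exact: gword_refl.
apply: gword_trans (gword_mulVw u).
by apply: gword_cat; [exact: gword_refl|exact: gword_sym].
Qed.

Definition pmul (a b : presented) : presented := pclass (repr a ++ repr b).
Definition pinv (a : presented) : presented := pclass (gword_inv (repr a)).

Lemma pmulE u v : pmul (pclass u) (pclass v) = pclass (u ++ v).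
Proof. by apply/pclassP/gword_cat; exact: repr_pclass. Qed.

Lemma pinvE u : pinv (pclass u) = pclass (gword_inv u).
Proof. by apply/pclassP/gword_inv_congr; exact: repr_pclass. Qed.

Lemma pmulA : associative pmul.
Proof.
by elim/pclass_ind=> u; elim/pclass_ind=> v; elim/pclass_ind=> w;
  rewrite !pmulE catA.
Qed.

Lemma pmul1 : left_id (pclass [::]) pmul.
Proof. by elim/pclass_ind=> u; rewrite pmulE. Qed.

Lemma pmulx1 : right_id (pclass [::]) pmul.
Proof. by elim/pclass_ind=> u; rewrite pmulE cats0. Qed.

Lemma pmulV : left_inverse (pclass [::]) pinv pmul.
Proof.
by elim/pclass_ind=> u; rewrite pinvE pmulE; apply/pclassP/gword_mulVw.
Qed.

Lemma pmulxV : right_inverse (pclass [::]) pinv pmul.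
Proof.
by elim/pclass_ind=> u; rewrite pinvE pmulE; apply/pclassP/gword_mulwV.
Qed.

HB.instance Definition _ :=
  isGroup.Build presented pmulA pmul1 pmulx1 pmulV pmulxV.

Definition pgen (x : X) : presented := pclass [:: ltr x].

End PresentedGroup.

Definition gword_eval (X : Type) (G : groupType) (a : X -> G) (u : gword X) : G :=
  \prod_(l <- u) (if l.2 then (a l.1)^-1 else a l.1).

Section Lift.
Variables (X : choiceType) (R : gword X -> gword X -> Prop).
Variables (G : groupType) (a : X -> G).

Definition respects : Prop :=
  forall u v, R u v -> gword_eval a u = gword_eval a v.

Lemma gword_eval_eq u v :
  respects -> gword_eq R u v -> gword_eval a u = gword_eval a v.
Proof.
move=> aR; elim=> {u v} [u v /aR //|x b| |u v _ -> //|u v w _ -> _ //|] //.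
  by rewrite /gword_eval !big_cons big_nil mulg1; case: b;
    rewrite ?mulVg ?mulgV.
by move=> u u' v v' _ Hu _ Hv; rewrite /gword_eval !big_cat /=; congr (_ * _).
Qed.

Definition plift (aR : respects) (p : presented R) : G := gword_eval a (repr p).

Variable aR : respects.

Lemma plift_class u : plift aR (pclass R u) = gword_eval a u.
Proof. by apply: gword_eval_eq => //; exact: repr_pclass. Qed.

Lemma plift_gen x : plift aR (pgen R x) = a x.
Proof. by rewrite plift_class /gword_eval big_seq1. Qed.

Lemma plift_morph : monoid_morphism (plift aR).
Proof.
split=> [|p q].
  by rewrite [1]/(pclass R [::]) plift_class /gword_eval big_nil.
elim/pclass_ind: p => u; elim/pclass_ind: q => v.
by rewrite [_ * _]pmulE !plift_class /gword_eval big_cat.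
Qed.

HB.instance Definition _ :=
  isUMagmaMorphism.Build (presented R) G (plift aR) plift_morph.

End Lift.

(* The family a of elements of G, with the relations u = v for R u v, is a
   presentation of G. *)
Definition is_presentation (G : groupType) (X : choiceType) (a : X -> G)
    (R : gword X -> gword X -> Prop) : Prop :=
  exists f : {multiplicative presented R -> G},
    (forall x, f (pgen R x) = a x) /\ bijective f.

(* Strands and generators are numbered from 0: the element k of 'I_n.-1 is the
   generator exchanging the strands k and k.+1 of 'I_n. *)
Section Braids.
Variable n : nat.

Inductive braid_rel : gword 'I_n.-1 -> gword 'I_n.-1 -> Prop :=
| braid_far (i j : 'I_n.-1) : (i.+1 < j)%N || (j.+1 < i)%N ->
    braid_rel [:: ltr i; ltr j] [:: ltr j; ltr i]
| braid_adj (i j : 'I_n.-1) : j = i.+1 :> nat ->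
    braid_rel [:: ltr i; ltr j; ltr i] [:: ltr j; ltr i; ltr j].

Definition braid := presented braid_rel.
HB.instance Definition _ := monoid.Group.on braid.

Definition strand (i : 'I_n.-1) : 'I_n := widen_ord (leq_pred n) i.
Definition strandS (i : 'I_n.-1) : 'I_n :=
  Ordinal (etrans (esym (ltn_predRL i n)) (ltn_ord i)).

Definition sigma_perm (i : 'I_n.-1) : 'S_n := tperm (strand i) (strandS i).

Lemma sigma_perm_rel : respects braid_rel sigma_perm.
Proof.
move=> u v.
have ltF (k l : 'I_n) : (k < l)%N || (l < k)%N -> k != l by rewrite -neq_ltn.
case=> {u v} i j ij; rewrite /gword_eval !big_cons big_nil /= !mulg1.
  by apply/commgP/conjg_fixP; rewrite tpermJ !tpermD //; apply: ltF => /=; lia.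
have jE : strandS i = strand j by apply: val_inj; rewrite /= ij.
have si : sigma_perm j ^ sigma_perm i = tperm (strand i) (strandS j).
  by rewrite tpermJ -jE tpermR tpermD //; apply: ltF => /=; lia.
have sj : sigma_perm i ^ sigma_perm j = tperm (strand i) (strandS j).
  by rewrite tpermJ jE tpermL tpermD //; apply: ltF => /=; lia.
by move: si sj; rewrite /conjg !tpermV => -> ->.
Qed.

Definition braid_perm : braid -> 'S_n := plift sigma_perm_rel.
HB.instance Definition _ := UMagmaMorphism.on braid_perm.

Lemma braid_perm1 : braid_perm 1 = 1.
Proof. exact: gmulf1. Qed.

Lemma braid_permM : {morph braid_perm : x y / x * y}.
Proof. exact: gmulfM. Qed.

Lemma braid_permV : {morph braid_perm : x / x^-1}.
Proof. exact: gmulfV. Qed.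

Definition pure_pred : {pred braid} := [pred b | braid_perm b == 1].

Lemma pure_predP (b : braid) : reflect (braid_perm b = 1) (b \in pure_pred).
Proof. exact: eqP. Qed.

Lemma pure_pred_closed : group_closed pure_pred.
Proof.
split=> [|x y /pure_predP x1 /pure_predP y1]; apply/pure_predP.
  exact: braid_perm1.
by rewrite braid_permM braid_permV x1 y1 mulgV.
Qed.

Record pure_braid := PureBraid {
  pure_val :> braid;
  pure_valP : pure_val \in pure_pred }.
HB.instance Definition _ := [isSub for pure_val].
HB.instance Definition _ := [Choice of pure_braid by <:].
HB.instance Definition _ :=
  SubChoice_isSubGroup.Build braid pure_pred pure_braid
    pure_pred_closed.

(* The value 1 for k >= n.-1 is never used below. *)
Definition sigma (k : nat) : braid :=
  if insub k is Some i then pgen braid_rel i else 1.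

Definition pure_index := {p : 'I_n * 'I_n | (p.1 < p.2)%N}.
HB.instance Definition _ := Finite.on pure_index.

Definition right_gen (i j : nat) : braid :=
  \prod_(i <= k < j.-1) (sigma k)^-1 * sigma j.-1 ^+ 2 *
    \prod_(k <- rev (index_iota i j.-1)) sigma k.

Lemma braid_perm_sigma2 k : braid_perm (sigma k ^+ 2) = 1.
Proof.
rewrite expgS expg1 braid_permM /sigma; case: insubP => [i _ _|_].
  by rewrite /braid_perm plift_gen tperm2.
by rewrite braid_perm1 mulg1.
Qed.

Lemma right_gen_pure i j : right_gen i j \in pure_pred.
Proof.
apply/pure_predP; rewrite /right_gen prodgV 2!braid_permM braid_perm_sigma2.
by rewrite mulg1 braid_permV mulVg.
Qed.

Definition pure_gen (p : pure_index) : pure_braid :=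
  PureBraid (right_gen_pure (val p).1 (val p).2).

Definition A_ (i j : 'I_n) (ij : (i < j)%N) : pure_index :=
  exist (fun p : 'I_n * 'I_n => (p.1 < p.2)%N) (i, j) ij.

Inductive pure_rel : gword pure_index -> gword pure_index -> Prop :=
| pure_P1 (i j r s : 'I_n) (ij : (i < j)%N) (rs : (r < s)%N) :
    [&& i < r, r < s & s < j]%N || [&& i < j, j < r & r < s]%N ->
    pure_rel [:: ltr (A_ ij); ltr (A_ rs)] [:: ltr (A_ rs); ltr (A_ ij)]
| pure_P2 (i r s : 'I_n) (ir : (i < r)%N) (rs : (r < s)%N) (is_ : (i < s)%N) :
    pure_rel [:: ltr (A_ ir); ltr (A_ is_); ltr (A_ rs)]
             [:: ltr (A_ is_); ltr (A_ rs); ltr (A_ ir)]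
| pure_P3 (i r s : 'I_n) (ir : (i < r)%N) (rs : (r < s)%N) (is_ : (i < s)%N) :
    pure_rel [:: ltr (A_ rs); ltr (A_ ir); ltr (A_ is_)]
             [:: ltr (A_ ir); ltr (A_ is_); ltr (A_ rs)]
| pure_P4 (i r j s : 'I_n) (ij : (i < j)%N) (rj : (r < j)%N) (rs : (r < s)%N) :
    (i < r)%N -> (j < s)%N ->
    pure_rel [:: ltr (A_ rj); ltr (A_ rs); ltrV (A_ rj); ltr (A_ ij)]
             [:: ltr (A_ ij); ltr (A_ rj); ltr (A_ rs); ltrV (A_ rj)].

End Braids.

(* Main.v *)
(* Let Q be the group with the proposed presentation. Conjugation by sigma_k
   permutes the generators A_ij up to conjugation by A_{k,k+1}; the same formulas
   define endomorphisms of Q that satisfy the braid relations and whose squares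
   are conjugation by A_{k,k+1}. They make B_n act on the set Q x S_n, where the
   pair (q, w) stands for the braid q * tau(w), tau(w) being the positive
   permutation braid of w: sigma_k sends (q, w) to (sigma_k(q), s_k w) at an
   ascent of w and to (sigma_k(q) A_{k,k+1}, s_k w) at a descent. The image of q
   in B_n acts as left multiplication by q, so Q -> P_n is injective. It is onto
   because every braid has the form q * tau(w), with w = 1 for a pure braid. *)
Require Import Defs.
From HB Require Import structures.
From mathcomp Require Import all_boot all_fingroup.
From mathcomp Require Import generic_quotient boolp zify.

Set Implicit Arguments.
Unset Strict Implicit.
Unset Printing Implicit Defensive.

Local Open Scope group_scope.

(** * The pure braid relations and the action of the braid generators *)

Lemma commuteJ (G : groupType) (x y g : G) :
  commute x y -> commute (x ^ g) (y ^ g).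
Proof. by rewrite /commute -!conjMg => ->. Qed.

Lemma commute_conjVl (G : groupType) (x y g : G) :
  commute (x ^ g^-1) y <-> commute x (y ^ g).
Proof.
by split=> /commuteJ; [move=> /(_ g)|move=> /(_ g^-1)]; rewrite ?conjgKV ?conjgK.
Qed.

Lemma commute_conjg (G : groupType) (x y : G) : commute x y -> x ^ y = x.
Proof. by move=> xy; apply/conjg_fixP/commgP. Qed.

(* The relations P2 and P3 for [i < r < s] say that [A_ir], [A_is], [A_rs] form
   such a triple. *)
Definition cyclic3 (G : groupType) (x y z : G) :=
  x * y * z = y * z * x /\ z * x * y = x * y * z.

Section Cyclic3.
Variables (G : groupType) (x y z : G).
Hypothesis xyz : cyclic3 x y z.

Lemma cyclic3_rot : cyclic3 y z x.
Proof. by case: xyz => e1 e2; split; rewrite ?e1 // -e1 -e2. Qed.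

(** The two equations make [y] commute with [z * x]. *)
Lemma cyclic3_conj : y ^ z = y ^ x^-1.
Proof.
case: xyz => e1 e2; rewrite !conjgE invgK; apply: (mulgI z); apply: (mulIg x).
by rewrite mulVKg !mulgA mulgVK e2.
Qed.

Lemma cyclic3J g : cyclic3 (x ^ g) (y ^ g) (z ^ g).
Proof. by case: xyz => e1 e2; split; rewrite -!conjMg ?e1 // -e1 -e2. Qed.

Lemma cyclic3_commute : commute z (x * y).
Proof. by case: xyz => _ e2; rewrite /commute mulgA. Qed.

(** All rotations of the new triple still multiply to [x * y * z]. Up to rotation, [twist] acts in
    this way on the triangle of [k], [k.+1] and a third strand. *)
Lemma cyclic3_turn : cyclic3 x z (y ^ x^-1).
Proof.
case: xyz => e1 e2; rewrite !conjgE invgK.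
have xzy : x * z * (x * (y * x^-1)) = x * y * z.
  by rewrite -2!mulgA (mulgA z) (mulgA (z * x)) e2 e1 !mulgA mulgK -!mulgA.
by split; rewrite xzy ?mulgA ?mulgVK ?e2.
Qed.

End Cyclic3.

(* The relations P1-P4 for a family indexed by all pairs of natural numbers;
   the values off [i < j < n] are irrelevant. *)
Record pure_family (n : nat) (G : groupType) (a : nat -> nat -> G) : Prop :=
  PureFamily {
    pf_nest i r s j : (i < r)%N -> (r < s)%N -> (s < j)%N -> (j < n)%N ->
      commute (a i j) (a r s);
    pf_disj i j r s : (i < j)%N -> (j < r)%N -> (r < s)%N -> (s < n)%N ->
      commute (a i j) (a r s);
    pf_tri i r s : (i < r)%N -> (r < s)%N -> (s < n)%N ->
      cyclic3 (a i r) (a i s) (a r s);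
    pf_cross i r s j : (i < r)%N -> (r < s)%N -> (s < j)%N -> (j < n)%N ->
      commute (a r j ^ (a r s)^-1) (a i s) }.

Definition swapS (k x : nat) : nat :=
  if x == k then k.+1 else if x == k.+1 then k else x.

(* The effect of conjugation by [sigma_k] on the pure braid generators. *)
Definition twist (G : groupType) (k : nat) (a : nat -> nat -> G) (i j : nat) : G :=
  if (i == k) && (j == k.+1) then a i j else
  if (i == k.+1) || (j == k.+1) then a (swapS k i) (swapS k j) ^ (a k k.+1)^-1
  else a (swapS k i) (swapS k j).

Section Twist.
Variables (G : groupType) (a : nat -> nat -> G) (k : nat).

Lemma twist_eq : twist k a k k.+1 = a k k.+1.
Proof. by rewrite /twist !eqxx. Qed.

Lemma twist_lo i j : i != k.+1 -> j != k.+1 ->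
  twist k a i j = a (swapS k i) (swapS k j).
Proof. by rewrite /twist => /negbTE-> /negbTE->; rewrite andbF. Qed.

Lemma twist_id i j : i != k -> i != k.+1 -> j != k -> j != k.+1 ->
  twist k a i j = a i j.
Proof.
by rewrite /twist /swapS => /negbTE-> /negbTE-> /negbTE-> /negbTE->.
Qed.

Lemma twist_kl j : (k.+1 < j)%N -> twist k a k j = a k.+1 j.
Proof.
move=> kj; rewrite twist_lo /swapS ?eqxx; try lia.
by rewrite !ifN //; lia.
Qed.

Lemma twist_kr i : (i < k)%N -> twist k a i k = a i k.+1.
Proof.
move=> ik; rewrite twist_lo /swapS ?eqxx; try lia.
by rewrite !ifN //; lia.
Qed.

Lemma twist_Skl j : (k.+1 < j)%N ->
  twist k a k.+1 j = a k j ^ (a k k.+1)^-1.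
Proof.
move=> kj; rewrite /twist /swapS !eqxx /= !ifN //; lia.
Qed.

Lemma twist_Skr i : (i < k)%N ->
  twist k a i k.+1 = a i k ^ (a k k.+1)^-1.
Proof.
move=> kj; rewrite /twist /swapS !eqxx orbT /= !ifN //; lia.
Qed.

End Twist.

(** * Stability of the pure braid relations under twisting *)

Section PureFamily.
Variables (n : nat) (G : groupType) (a : nat -> nat -> G).
Hypothesis fa : pure_family n a.

(** P4 with the conjugation carried over to [a i s], then moved to [a i r] around the triangle
    [i, r, s]. This form and [pf_crossr] are what [twist] makes of nested pairs in [twist_nest]. *)
Lemma pf_crossl i r s j : (i < r)%N -> (r < s)%N -> (s < j)%N -> (j < n)%N ->
  commute (a r j) (a i s ^ (a i r)^-1).
Proof.
move=> ir rs sj jn; have := pf_cross fa ir rs sj jn.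
rewrite commute_conjVl (cyclic3_conj (pf_tri fa ir rs _)) //; lia.
Qed.

(* Move the conjugation around the triangles [irs], [irj] and [isj]. *)
Lemma pf_crossr i r s j : (i < r)%N -> (r < s)%N -> (s < j)%N -> (j < n)%N ->
  commute (a r j) (a i s ^ (a s j)^-1).
Proof.
move=> ir rs sj jn.
have /commute_sym := pf_crossl ir rs sj jn; rewrite commute_conjVl.
have irj : cyclic3 (a i r) (a i j) (a r j) by apply: (pf_tri fa) => //; lia.
have isj : cyclic3 (a i s) (a i j) (a s j) by apply: (pf_tri fa) => //; lia.
rewrite (cyclic3_conj (cyclic3_rot irj)) => /commute_sym /commute_conjVl.
by rewrite (cyclic3_conj (cyclic3_rot (cyclic3_rot isj))).
Qed.

(** Off [k], twisting is a renumbering followed by one fixed conjugation, because generators that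
    also avoid [k.+1] commute with [a k k.+1]. Off [k.+1] it is a bare renumbering, by [twist_lo].
    So a relation needs work only when both [k] and [k.+1] are among its indices. *)
Lemma twist_hi k i j : (k.+1 < n)%N -> (i < j)%N -> (j < n)%N ->
  i != k -> j != k ->
  twist k a i j = a (swapS k i) (swapS k j) ^ (a k k.+1)^-1.
Proof.
move=> kn ij jn ik jk; rewrite /twist (negbTE ik) /=.
case: ifPn => // /norP[iSk jSk].
rewrite /swapS (negbTE ik) (negbTE jk) (negbTE iSk) (negbTE jSk).
symmetry; apply: commute_conjg; apply: commuteV.
have [ltjk|ltkj] := ltnP j k; first by apply: (pf_disj fa) => //; lia.
have [ltik|ltki] := ltnP i k; first by apply: (pf_nest fa) => //; lia.
by apply: commute_sym; apply: (pf_disj fa) => //; lia.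
Qed.

Ltac lia_swapS := rewrite /swapS; repeat case: eqP => ?; lia.

Lemma twist_nest k i r s j : (k.+1 < n)%N ->
  (i < r)%N -> (r < s)%N -> (s < j)%N -> (j < n)%N ->
  commute (twist k a i j) (twist k a r s).
Proof.
move=> kn ir rs sj jn.
case: (boolP [&& i != k, r != k, s != k & j != k]) => [/and4P[ik rk sk jk]|hk].
  rewrite !twist_hi //; try lia.
  by apply: commuteJ; apply: (pf_nest fa); lia_swapS.
case: (boolP [&& i != k.+1, r != k.+1, s != k.+1 & j != k.+1]) => [/and4P[? ? ? ?]|hSk].
  by rewrite !twist_lo //; apply: (pf_nest fa); lia_swapS.
(* Both [k] and [k.+1] occur, so they are neighbours in the order of the four indices. *)
have [[? ?]|[[? ?]|[? ?]]] :
    i = k /\ r = k.+1 \/ r = k /\ s = k.+1 \/ s = k /\ j = k.+1 by lia.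
- subst; rewrite twist_kl ?twist_Skl; try lia.
  by apply: pf_crossl => //; lia.
- subst; rewrite twist_eq twist_id; try lia.
  exact: (pf_nest fa).
- subst; rewrite twist_kr ?twist_Skr; try lia.
  by apply/commute_sym/pf_crossr.
Qed.

Lemma twist_disj k i j r s : (k.+1 < n)%N ->
  (i < j)%N -> (j < r)%N -> (r < s)%N -> (s < n)%N ->
  commute (twist k a i j) (twist k a r s).
Proof.
move=> kn ij jr rs sn.
case: (boolP [&& i != k, j != k, r != k & s != k]) => [/and4P[ik rk sk jk]|hk].
  rewrite !twist_hi //; try lia.
  by apply: commuteJ; apply: (pf_disj fa); lia_swapS.
case: (boolP [&& i != k.+1, j != k.+1, r != k.+1 & s != k.+1]) => [/and4P[? ? ? ?]|hSk].
  by rewrite !twist_lo //; apply: (pf_disj fa); lia_swapS.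
have [[? ?]|[[? ?]|[? ?]]] :
    i = k /\ j = k.+1 \/ j = k /\ r = k.+1 \/ r = k /\ s = k.+1 by lia.
- subst; rewrite twist_eq twist_id; try lia.
  by apply: (pf_disj fa).
(* Twisting makes the two disjoint pairs cross. *)
- subst; rewrite twist_kr ?twist_Skl; try lia.
  by apply: commute_sym; apply: (pf_cross fa) => //; lia.
- subst; rewrite twist_eq twist_id; try lia.
  by apply: (pf_disj fa).
Qed.

Lemma twist_tri k i r s : (k.+1 < n)%N ->
  (i < r)%N -> (r < s)%N -> (s < n)%N ->
  cyclic3 (twist k a i r) (twist k a i s) (twist k a r s).
Proof.
move=> kn ir rs sn.
case: (boolP [&& i != k, r != k & s != k]) => [/and3P[ik rk sk]|hk].
  rewrite !twist_hi //; try lia.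
  by apply: cyclic3J; apply: (pf_tri fa); lia_swapS.
case: (boolP [&& i != k.+1, r != k.+1 & s != k.+1]) => [/and3P[? ? ?]|hSk].
  by rewrite !twist_lo //; apply: (pf_tri fa); lia_swapS.
have [[? ?]|[? ?]] : i = k /\ r = k.+1 \/ r = k /\ s = k.+1 by lia.
- subst; rewrite twist_eq twist_kl ?twist_Skl; try lia.
  by apply/cyclic3_turn/(pf_tri fa).
- subst; rewrite twist_eq twist_kr ?twist_Skr; try lia.
  by apply/cyclic3_rot/cyclic3_turn/cyclic3_rot/cyclic3_rot/(pf_tri fa).
Qed.

(** When both [k] and [k.+1] occur, the twist uncrosses the pairs: the last three cases rest on a
    nested, a disjoint and again a nested pair. *)
Lemma twist_cross k i r s j : (k.+1 < n)%N ->
  (i < r)%N -> (r < s)%N -> (s < j)%N -> (j < n)%N ->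
  commute (twist k a r j ^ (twist k a r s)^-1) (twist k a i s).
Proof.
move=> kn ir rs sj jn.
case: (boolP [&& i != k, r != k, s != k & j != k]) => [/and4P[ik rk sk jk]|hk].
  rewrite !twist_hi //; try lia.
  by rewrite -conjVg -conjJg; apply: commuteJ; apply: (pf_cross fa); lia_swapS.
case: (boolP [&& i != k.+1, r != k.+1, s != k.+1 & j != k.+1]) => [/and4P[? ? ? ?]|hSk].
  by rewrite !twist_lo //; apply: (pf_cross fa); lia_swapS.
have [[? ?]|[[? ?]|[? ?]]] :
    i = k /\ r = k.+1 \/ r = k /\ s = k.+1 \/ s = k /\ j = k.+1 by lia.
- subst; have [kj Sks] : (k.+1 < j)%N /\ (s < n)%N by lia.
  rewrite twist_kl ?twist_Skl //.
  (* Moved to the other side, the conjugation is by [a k k.+1 * a k s], which commutes with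
     [a k.+1 s]. *)
  rewrite -conjVg -conjJg -conjgM -invgM commute_conjVl.
  rewrite [X in commute _ X]commute_conjg.
    by apply: (pf_nest fa) => //; lia.
  exact/cyclic3_commute/(pf_tri fa).
- subst; rewrite twist_eq twist_kl ?twist_Skr //.
  by apply: commuteJ; apply: commute_sym; apply: (pf_disj fa).
- subst; rewrite twist_Skr // !twist_kr //; last lia.
  rewrite -conjgM -invgM commute_conjg.
    by apply: commute_sym; apply: (pf_nest fa) => //; lia.
  apply/commuteV/cyclic3_commute/cyclic3_rot/(pf_tri fa) => //; lia.
Qed.

Lemma twist_family k : (k.+1 < n)%N -> pure_family n (twist k a).
Proof.
move=> kn; split=> *;
  [exact: twist_nest|exact: twist_disj|exact: twist_tri|exact: twist_cross].
Qed.

End PureFamily.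

(** * The braid generators as endomorphisms of the presented group *)

Lemma presented_ind (X : choiceType) (R : seq (X * bool) -> seq (X * bool) -> Prop)
    (P : presented R -> Prop) :
  P 1 -> (forall x, P (pgen R x)) -> (forall p q, P p -> P q -> P (p * q)) ->
  (forall p, P p -> P p^-1) -> forall p, P p.
Proof.
move=> P1 Pg PM PV; elim/pclass_ind => u.
elim: u => [|[x b] u Pu] //.
rewrite -[(x, b) :: u]/([:: (x, b)] ++ u) -pmulE; apply: PM => //.
case: b; last exact: Pg.
by have := PV _ (Pg x); rewrite [_^-1]pinvE.
Qed.

Lemma gword_eval_pgen (X : choiceType) (R : seq (X * bool) -> seq (X * bool) -> Prop)
    (u : seq (X * bool)) : gword_eval (pgen R) u = pclass R u.
Proof.
rewrite /gword_eval; elim: u => [|[x b] u IHu]; first by rewrite big_nil.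
rewrite big_cons IHu -[(x, b) :: u]/([:: (x, b)] ++ u) -pmulE; congr (_ * _).
by case: b => //=; rewrite [LHS]pinvE.
Qed.

Lemma pgen_rel (X : choiceType) (R : seq (X * bool) -> seq (X * bool) -> Prop) u v :
  R u v -> gword_eval (pgen R) u = gword_eval (pgen R) v.
Proof. by move=> Ruv; rewrite !gword_eval_pgen; apply/pclassP/gword_rel. Qed.

(** With [plift], every family satisfying the relations gives a homomorphism out of the presented
    group. *)
Lemma pure_family_respects n (G : groupType) (a : nat -> nat -> G) :
  pure_family n a ->
  respects (@pure_rel n) (fun p => a (val p).1 (val p).2).
Proof.
move=> fa u v [] {u v}.
- move=> i j r s ij rs; rewrite /gword_eval !big_cons big_nil /= !mulg1.
  case/orP=> /and3P[? ? ?]; first exact: (pf_nest fa).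
  exact: (pf_disj fa).
- move=> i r s ir rs is_; rewrite /gword_eval !big_cons big_nil /= !mulg1.
  by rewrite !mulgA; case: (pf_tri fa ir rs (ltn_ord s)).
- move=> i r s ir rs is_; rewrite /gword_eval !big_cons big_nil /= !mulg1.
  by rewrite !mulgA; case: (pf_tri fa ir rs (ltn_ord s)).
- move=> i r j s ij rj rs ir js; rewrite /gword_eval !big_cons big_nil /= !mulg1.
  (* The indices of [pf_cross] are ordered [i < r < s < j], so the [j] and [s] of P4 are
     exchanged. *)
  have := pf_cross fa ir rj js (ltn_ord s).
  by rewrite /commute conjgE invgK !mulgA.
Qed.

(** Brings relations checked in the braid group back to its pure subgroup. *)
Lemma pure_family_morph n (G H : groupType) (f : UMagmaMorphism.type G H)
    (a : nat -> nat -> G) :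
  injective f -> pure_family n (fun i j => f (a i j)) -> pure_family n a.
Proof.
move=> f_inj fa.
have comm x y : commute (f x) (f y) -> commute x y.
  by rewrite /commute -!gmulfM => /f_inj.
split=> [*|*|i r s ir rs sn|*].
- by apply: comm; apply: (pf_nest fa).
- by apply: comm; apply: (pf_disj fa).
- have [e1 e2] := pf_tri fa ir rs sn.
  by split; apply: f_inj; rewrite !gmulfM.
- by apply: comm; rewrite gmulfJ gmulfV; apply: (pf_cross fa).
Qed.

Section TwistMorphism.
Variable n : nat.
Local Notation Q := (presented (@pure_rel n)).

(** Natural-number indices allow index arithmetic; the default 1 occurs only off [i < j < n]. *)
Definition Agen (i j : nat) : Q :=
  if [pick p : pure_index n | ((val p).1 == i :> nat) && ((val p).2 == j :> nat)]
    is Some p then pgen _ p else 1.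

Lemma AgenE (p : pure_index n) : Agen (val p).1 (val p).2 = pgen _ p.
Proof.
rewrite /Agen; case: pickP => [q /andP[/eqP e1 /eqP e2]|/(_ p)]; last first.
  by rewrite !eqxx.
congr pgen; apply: val_inj; rewrite [LHS]surjective_pairing.
by rewrite [RHS]surjective_pairing; congr pair; apply: val_inj.
Qed.

Lemma Agen_ord (i j : 'I_n) (ij : (i < j)%N) : Agen i j = pgen _ (A_ ij).
Proof. by rewrite -AgenE. Qed.

Lemma Agen_rel u v : @pure_rel n u v ->
  gword_eval (fun p : pure_index n => Agen (val p).1 (val p).2) u =
  gword_eval (fun p : pure_index n => Agen (val p).1 (val p).2) v.
Proof.
move=> Ruv; rewrite (_ : (fun p : pure_index n => _) = pgen (@pure_rel n)).
  exact: pgen_rel.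
by apply: functional_extensionality_dep => p; rewrite AgenE.
Qed.

Lemma Agen_family : pure_family n Agen.
Proof.
have E i : (i < n)%N -> exists i' : 'I_n, i = i' by move=> ltin; exists (Ordinal ltin).
split.
- move=> i r s j ir rs sj jn.
  have [[i' ei] [r' er] [s' es] [j' ej]] :
    [/\ exists i' : 'I_n, i = i', exists i' : 'I_n, r = i',
        exists i' : 'I_n, s = i' & exists i' : 'I_n, j = i'] by split; apply: E; lia.
  subst; have ij : (i' < j')%N by lia.
  have := @Agen_rel [:: ltr (A_ ij); ltr (A_ rs)] [:: ltr (A_ rs); ltr (A_ ij)].
  rewrite /gword_eval !big_cons big_nil /= !mulg1; apply; apply: pure_P1.
  by rewrite ir rs sj.
- move=> i r s j ir rs sj jn.
  have [[i' ei] [r' er] [s' es] [j' ej]] :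
    [/\ exists i' : 'I_n, i = i', exists i' : 'I_n, r = i',
        exists i' : 'I_n, s = i' & exists i' : 'I_n, j = i'] by split; apply: E; lia.
  subst.
  have := @Agen_rel [:: ltr (A_ ir); ltr (A_ sj)] [:: ltr (A_ sj); ltr (A_ ir)].
  rewrite /gword_eval !big_cons big_nil /= !mulg1; apply; apply: pure_P1.
  by rewrite ir rs sj orbT.
- move=> i r s ir rs sn.
  have [[i' ei] [r' er] [s' es]] :
    [/\ exists i' : 'I_n, i = i', exists i' : 'I_n, r = i' &
        exists i' : 'I_n, s = i'] by split; apply: E; lia.
  subst; have is_ : (i' < s')%N by lia.
  have := Agen_rel (pure_P2 ir rs is_); have := Agen_rel (pure_P3 ir rs is_).
  by rewrite /gword_eval !big_cons big_nil /= !mulg1 !mulgA; split.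
- move=> i r s j ir rs sj jn.
  have [[i' ei] [r' er] [s' es] [j' ej]] :
    [/\ exists i' : 'I_n, i = i', exists i' : 'I_n, r = i',
        exists i' : 'I_n, s = i' & exists i' : 'I_n, j = i'] by split; apply: E; lia.
  subst; have [is_ rj] : (i' < s')%N /\ (r' < j')%N by lia.
  have := Agen_rel (pure_P4 is_ rs rj ir sj).
  by rewrite /gword_eval !big_cons big_nil /= !mulg1 /commute conjgE invgK !mulgA.
Qed.

Lemma Agen_ind (P : Q -> Prop) :
  P 1 -> (forall i j, (i < j)%N -> (j < n)%N -> P (Agen i j)) ->
  (forall p q, P p -> P q -> P (p * q)) -> (forall p, P p -> P p^-1) ->
  forall p, P p.
Proof.
move=> P1 PA PM PV; apply: presented_ind => // x.
by rewrite -AgenE; apply: PA; [exact: (valP x)|exact: ltn_ord].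
Qed.

Lemma lt_succ_ord (k : 'I_n.-1) : (k.+1 < n)%N.
Proof. by have := ltn_ord k; lia. Qed.

(** Models the map sending [b] to [sigma_k b sigma_k^-1]; [pure_map_twist] makes this precise. *)
Definition twistQ (k : 'I_n.-1) : Q -> Q :=
  plift (pure_family_respects (twist_family Agen_family (lt_succ_ord k))).
HB.instance Definition _ k := UMagmaMorphism.on (twistQ k).

Lemma twistQ_gen (k : 'I_n.-1) i j : (i < j)%N -> (j < n)%N ->
  twistQ k (Agen i j) = twist k Agen i j.
Proof.
move=> ij jn; have ltin : (i < n)%N by lia.
by rewrite (@Agen_ord (Ordinal ltin) (Ordinal jn) ij) /twistQ plift_gen.
Qed.

Section TwistQRules.
Variable k : 'I_n.-1.

Lemma twistQ1 : twistQ k 1 = 1.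
Proof. exact: gmulf1. Qed.

Lemma twistQM : {morph twistQ k : p q / p * q}.
Proof. exact: gmulfM. Qed.

Lemma twistQV : {morph twistQ k : p / p^-1}.
Proof. exact: gmulfV. Qed.

Lemma twistQJ : {morph twistQ k : p q / p ^ q}.
Proof. exact: gmulfJ. Qed.

(* The index [m] is kept apart from the ordinal [k] to allow rewriting with
   [m := k'.+1] for another generator [k']. *)
Lemma twistQ_eq m : m = k :> nat -> twistQ k (Agen m m.+1) = Agen m m.+1.
Proof. by move->; rewrite twistQ_gen ?twist_eq ?lt_succ_ord. Qed.

Lemma twistQ_id i j : (i < j)%N -> (j < n)%N ->
  i != k -> i != k.+1 -> j != k -> j != k.+1 -> twistQ k (Agen i j) = Agen i j.
Proof. by move=> ij jn *; rewrite twistQ_gen ?twist_id. Qed.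

Lemma twistQ_kl m j : m = k :> nat -> (m.+1 < j)%N -> (j < n)%N ->
  twistQ k (Agen m j) = Agen m.+1 j.
Proof. by move=> -> *; rewrite twistQ_gen ?twist_kl // ltnW. Qed.

Lemma twistQ_kr m i : m = k :> nat -> (i < m)%N ->
  twistQ k (Agen i m) = Agen i m.+1.
Proof. by move=> -> *; rewrite twistQ_gen ?twist_kr // ltnW // lt_succ_ord. Qed.

Lemma twistQ_Skl m j : m = k :> nat -> (m.+1 < j)%N -> (j < n)%N ->
  twistQ k (Agen m.+1 j) = Agen m j ^ (Agen m m.+1)^-1.
Proof. by move=> -> *; rewrite twistQ_gen ?twist_Skl. Qed.

Lemma twistQ_Skr m i : m = k :> nat -> (i < m)%N ->
  twistQ k (Agen i m.+1) = Agen i m ^ (Agen m m.+1)^-1.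
Proof. by move=> -> *; rewrite twistQ_gen ?twist_Skr ?lt_succ_ord // ltnW. Qed.

End TwistQRules.

Ltac twistQ_simpl :=
  repeat first [ rewrite twistQJ | rewrite twistQV | rewrite twistQ_eq; [|lia]
    | rewrite twistQ_id; [|lia|lia|lia|lia|lia|lia]
    | rewrite twistQ_kl; [|lia|lia|lia] | rewrite twistQ_kr; [|lia|lia]
    | rewrite twistQ_Skl; [|lia|lia|lia] | rewrite twistQ_Skr; [|lia|lia] ].

Lemma twistQ_sqr k q : twistQ k (twistQ k q) = q ^ (Agen k k.+1)^-1.
Proof.
have kn := lt_succ_ord k.
elim/Agen_ind: q => [|i j ij jn|p q Hp Hq|p Hp].
- by rewrite !twistQ1 conj1g.
- have [ik|ik] := eqVneq i k.
    subst i; have [jk|jk] := eqVneq j k.+1.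
      by subst j; twistQ_simpl; rewrite commute_conjg //; apply/commuteV.
    by twistQ_simpl.
  have [jk|jk] := eqVneq j k; first by subst j; twistQ_simpl.
  have [iSk|iSk] := eqVneq i k.+1; first by subst i; twistQ_simpl.
  have [jSk|jSk] := eqVneq j k.+1; first by subst j; twistQ_simpl.
  (* Both indices avoid [k] and [k.+1]; comparing [twist_hi] with [twist_id] shows that the
     conjugation fixes this generator. *)
  twistQ_simpl; have := twist_hi Agen_family kn ij jn ik jk.
  by rewrite twist_id // /swapS (negbTE ik) (negbTE iSk) (negbTE jk) (negbTE jSk).
- by rewrite !twistQM Hp Hq conjMg.
- by rewrite !twistQV Hp conjVg.
Qed.

Lemma twistQ_far (k l : 'I_n.-1) q : (k.+1 < l)%N ->
  twistQ k (twistQ l q) = twistQ l (twistQ k q).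
Proof.
move=> kl; have [kn ln] := (lt_succ_ord k, lt_succ_ord l).
elim/Agen_ind: q => [|i j ij jn|p q Hp Hq|p Hp].
- by rewrite !twistQ1.
- have far (m : nat) : m = k :> nat \/ m = k.+1 \/ m = l :> nat \/ m = l.+1 \/
      (m != k /\ m != k.+1 /\ m != l /\ m != l.+1) by lia.
  case: (far i) => [?|[?|[?|[?|[? [? [? ?]]]]]]];
    case: (far j) => [?|[?|[?|[?|[? [? [? ?]]]]]]];
    try (exfalso; lia); try subst i; try subst j; twistQ_simpl; try done.
  (* Only [Agen k.+1 l.+1] is left: each side conjugates by the inverses of [Agen k k.+1] and
     [Agen l l.+1], in opposite orders. *)
  rewrite -!conjgM; congr (_ ^ _); apply/commuteV/commute_sym/commuteV.
  by apply: commute_sym; apply: (pf_disj Agen_family).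
- by rewrite !twistQM Hp Hq.
- by rewrite !twistQV Hp.
Qed.

Section TwistQBraid.
Variables (k l : 'I_n.-1).
Hypothesis kl : l = k.+1 :> nat.

(** This is P2 for [k], [k.+1], [k.+2]. The left side is [twistQ l (twistQ k (Agen k.+1 k.+2))]. *)
Lemma twistQ_adj_fix :
  (Agen k k.+1 ^ (Agen k.+1 k.+2)^-1) ^ (Agen k k.+2)^-1 = Agen k k.+1.
Proof.
have kn := lt_succ_ord l; have akl : cyclic3 (Agen k k.+1) (Agen k k.+2) (Agen k.+1 k.+2).
  by apply: (pf_tri Agen_family) => //; lia.
rewrite -conjgM -invgM; apply/commute_conjg/commuteV.
exact/cyclic3_commute/cyclic3_rot.
Qed.

Lemma twistQ_adj q :
  twistQ k (twistQ l (twistQ k q)) = twistQ l (twistQ k (twistQ l q)).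
Proof.
have kn := lt_succ_ord k; have := lt_succ_ord l; rewrite kl => ln.
elim/Agen_ind: q => [|i j ij jn|p q Hp Hq|p Hp].
- by rewrite !twistQ1.
- have adj (m : nat) : m = k :> nat \/ m = k.+1 \/ m = k.+2 \/
      (m != k /\ m != k.+1 /\ m != k.+2) by lia.
  case: (adj i) => [?|[?|[?|[? [? ?]]]]]; case: (adj j) => [?|[?|[?|[? [? ?]]]]];
    try (exfalso; lia); try subst i; try subst j; twistQ_simpl; try done.
  (* The generators left are, in order, [Agen k k.+2], [Agen k.+1 k.+2], [Agen k.+2 j] with
     [k.+2 < j], and [Agen i k.+2] with [i < k]. *)
  + by rewrite twistQ_adj_fix.
  + have [e1 e2] : cyclic3 (Agen k k.+1) (Agen k k.+2) (Agen k.+1 k.+2).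
      by apply: (pf_tri Agen_family) => //; lia.
    rewrite -!conjgM -!invgM; congr (_ ^ _^-1).
    by rewrite conjgE invgK !mulgA e2 e1 mulgK.
  + by rewrite twistQ_adj_fix -conjVg -conjJg.
  + by rewrite twistQ_adj_fix -conjVg -conjJg.
- by rewrite !twistQM Hp Hq.
- by rewrite !twistQV Hp.
Qed.

End TwistQBraid.

End TwistMorphism.

(** * The right pure braid generators in the braid group *)

(** Follows the recursion [right_genS] on the left end of a generator. *)
Lemma ltn_pair_ind (P : nat -> nat -> Prop) :
  (forall i, P i i.+1) -> (forall i j, (i.+1 < j)%N -> P i.+1 j -> P i j) ->
  forall i j, (i < j)%N -> P i j.
Proof.
move=> P0 PS i j; have [m] := ubnP (j - i); elim: m i => // m IHm i lem ij.
have [->|ne] := eqVneq j i.+1; first exact: P0.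
by apply: PS; [|apply: IHm]; lia.
Qed.

Section RightGen.
Variable n : nat.
Local Notation sg := (sigma n).
Local Notation rg := (right_gen n).

Lemma sigmaE (k : 'I_n.-1) : sg k = pgen _ k.
Proof. by rewrite /sigma valK. Qed.

Lemma sigma_far k l : (k.+1 < l)%N -> commute (sg k) (sg l).
Proof.
move=> kl; rewrite /sigma.
case: insubP => [k' _ Ek|_]; last exact/commute_sym/commute1.
case: insubP => [l' _ El|_]; last exact: commute1.
have R : @braid_rel n [:: ltr k'; ltr l'] [:: ltr l'; ltr k'].
  by apply: braid_far; rewrite Ek El kl.
by have := pgen_rel R; rewrite /gword_eval !big_cons big_nil /= !mulg1.
Qed.

Lemma sigma_adj k : (k.+2 < n)%N ->
  sg k * sg k.+1 * sg k = sg k.+1 * sg k * sg k.+1.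
Proof.
move=> kn; have [k1 k2] : (k < n.-1)%N /\ (k.+1 < n.-1)%N by lia.
rewrite -[k]/(val (Ordinal k1)) -[(val _).+1]/(val (Ordinal k2)) !sigmaE.
have R := @braid_adj n (Ordinal k1) (Ordinal k2) erefl.
by have := pgen_rel R; rewrite /gword_eval !big_cons big_nil /= !mulg1 !mulgA.
Qed.

Lemma right_gen_eq k : rg k k.+1 = sg k * sg k.
Proof.
rewrite /right_gen /= /index_iota subnn /= !big_nil mul1g mulg1.
by rewrite expgS expg1.
Qed.

Lemma right_genS i j : (i.+1 < j)%N -> rg i j = rg i.+1 j ^ sg i.
Proof.
move=> ij; rewrite /right_gen big_ltn; last lia.
have -> : index_iota i j.-1 = i :: index_iota i.+1 j.-1.
  by rewrite /index_iota (_ : (j.-1 - i = (j.-1 - i.+1).+1)%N) //; lia.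
by rewrite rev_cons big_rcons conjgE !mulgA.
Qed.

(** The generator is a word in [sg i], ..., [sg j.-1] and their inverses. *)
Lemma commute_right_gen x i j : (i < j)%N ->
  (forall k, (i <= k)%N -> (k < j)%N -> commute x (sg k)) -> commute x (rg i j).
Proof.
elim/ltn_pair_ind: i j / => [k|i j ij IHi] xk.
  by rewrite right_gen_eq; apply: commuteM; apply: xk.
have xi : commute x (sg i) by apply: xk; lia.
rewrite right_genS // conjgE; apply: commuteM; first exact: commuteV.
by apply: commuteM => //; apply: IHi => k ik kj; apply: xk; lia.
Qed.

(** The base case is the braid relation in the form [sg k.+1 ^ sg k = sg k ^ (sg k.+1)^-1]; after
    that, the conjugations at the two ends commute. *)
Lemma right_gen_jS i j : (i < j)%N -> (j.+1 < n)%N ->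
  rg i j.+1 = rg i j ^ (sg j)^-1.
Proof.
elim/ltn_pair_ind: i j / => [k|i j ij IHi] jn; rewrite right_genS; try lia.
  rewrite !right_gen_eq !conjMg.
  suff -> : sg k.+1 ^ sg k = sg k ^ (sg k.+1)^-1 by [].
  rewrite !conjgE invgK.
  apply: (mulgI (sg k)); apply: (mulIg (sg k.+1)).
  by rewrite mulVKg !mulgA mulgVK sigma_adj.
rewrite IHi // (right_genS ij) -!conjgM; congr (_ ^ _).
by apply/commute_sym/commuteV/sigma_far.
Qed.

Lemma right_gen_inner i j k : (i < k)%N -> (k.+1 < j)%N -> (k.+1 < n)%N ->
  commute (rg i j) (sg k).
Proof.
move=> ik kj kn; have ij : (i < j)%N by lia.
elim/ltn_pair_ind: i j / ij ik kj => [i|i j ij IHi] ik kj; first lia.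
have [ltik|leki] := ltnP i.+1 k.
  rewrite right_genS // -(@commute_conjg _ (sg k) (sg i)).
    by apply: commuteJ; apply: IHi.
  by apply/commute_sym/sigma_far.
have {ik leki} Ek : k = i.+1 by lia.
subst k; rewrite right_genS; last lia.
rewrite right_genS // -conjgM.
(* Both elements become conjugates by [sg i.+1 * sg i], of [rg i.+2 j] and of [sg i], which
   commute. *)
have {2}-> : sg i.+1 = sg i ^ (sg i.+1 * sg i).
  by rewrite conjgE [sg i * _]mulgA sigma_adj // mulKg.
apply/commuteJ/commute_sym/commute_right_gen => // k ik kj'.
by apply: sigma_far; lia.
Qed.

Lemma right_gen_fix i j k : (i < j)%N -> (j < n)%N -> (k.+1 < n)%N ->
  i != k -> i != k.+1 -> j != k -> j != k.+1 -> commute (rg i j) (sg k).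
Proof.
move=> ij jn kn ik iSk jk jSk.
have [ltik|leki] := ltnP i k; last first.
  apply/commute_sym/commute_right_gen => // l *; apply: sigma_far; lia.
have [ltkj|lejk] := ltnP k.+1 j; first exact: right_gen_inner.
apply/commute_sym/commute_right_gen => // l *; apply/commute_sym/sigma_far; lia.
Qed.

(** The origin of [twist]: an index [k] uses the recursion at that end, and an index [k.+1] inverts
    it at the cost of [sg k * sg k], which is [rg k k.+1]. *)
Lemma twist_right_gen k i j : (k.+1 < n)%N -> (i < j)%N -> (j < n)%N ->
  twist k rg i j = rg i j ^ (sg k)^-1.
Proof.
move=> kn ij jn.
have [ik|ik] := eqVneq i k.
  subst i; have [jk|jk] := eqVneq j k.+1.
    by subst j; rewrite twist_eq right_gen_eq commute_conjg //;
      apply/commuteV/commute_sym/commuteM.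
  have Skj : (k.+1 < j)%N by lia.
  by rewrite (twist_kl _ Skj) (right_genS Skj) conjgK.
have [jk|jk] := eqVneq j k; first by subst j; rewrite (twist_kr _ ij) (right_gen_jS ij).
have [iSk|iSk] := eqVneq i k.+1.
  by subst i; rewrite (twist_Skl _ ij) (right_genS ij) right_gen_eq invgM -conjgM mulVKg.
have [jSk|jSk] := eqVneq j k.+1.
  have ltik : (i < k)%N by lia.
  by subst j; rewrite (twist_Skr _ ltik) (right_gen_jS ltik kn) right_gen_eq invgM conjgM.
rewrite (twist_id _ ik iSk jk jSk) commute_conjg //.
exact/commuteV/right_gen_fix.
Qed.

(** Conjugations by the generators [sg i] reduce to [r = i.+1]. Put [g = sg i] and [y = rg i s]: the
    triple is then [g * g], [y], [y ^ g^-1], and all its rotations agree once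
    [y * g * y * g = g * y * g * y]. *)
Lemma right_gen_tri i r s : (i < r)%N -> (r < s)%N -> (s < n)%N ->
  cyclic3 (rg i r) (rg i s) (rg r s).
Proof.
elim/ltn_pair_ind: i r / => [i|i r ir IHi] rs sn; last first.
  have /commute_conjg <- : commute (rg r s) (sg i).
    by apply: right_gen_fix; lia.
  rewrite right_genS // (@right_genS i s); last lia.
  by apply: cyclic3J; apply: IHi.
have -> : rg i.+1 s = rg i s ^ (sg i)^-1 by rewrite (@right_genS i s) ?conjgK.
have key : rg i s * sg i * rg i s * sg i = sg i * rg i s * sg i * rg i s.
  have {rs} : (i.+1 < s)%N by []; have [m] := ubnP (s - i).
  elim: m s sn => // m IHm s sn ltm si.
  have [Es|ne] := eqVneq s i.+2.
    subst s; rewrite right_genS // right_gen_eq.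
    set p := sg i; set q := sg i.+1.
    have pqp : p * q * p = q * p * q by exact: sigma_adj.
    (* The half twist [p * q * p] on three strands exchanges [p] and [q] by conjugation. Its square
       is [q * q * p * q * q * p], which therefore commutes with [p]. *)
    have pD : p * (p * q * p) = p * q * p * q by rewrite {1}pqp !mulgA.
    have qD : q * (p * q * p) = p * q * p * p by rewrite [in RHS]pqp !mulgA.
    have WD : q * q * p * q * q * p = p * q * p * (p * q * p).
      transitivity (q * (q * p * q) * (q * p)); first by rewrite !mulgA.
      rewrite -pqp; transitivity (q * p * q * (p * q * p)); first by rewrite !mulgA.
      by rewrite -pqp.
    have W : commute p (q * q * p * q * q * p).
      by rewrite WD /commute mulgA pD -mulgA qD !mulgA.
    rewrite conjgE; apply: (mulgI p); move: W; rewrite /commute.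
    by rewrite !mulgA mulgV mul1g !mulgK => <-.
  (* The case of [s] is that of [s.-1] conjugated by [(sg s.-1)^-1], which commutes with [sg i]. *)
  have Es : s = s.-1.+1 by lia.
  rewrite Es right_gen_jS; try lia.
  have /commute_conjg <- : commute (sg i) (sg s.-1)^-1.
    by apply/commuteV/sigma_far; lia.
  by rewrite -!conjMg IHm //; lia.
rewrite right_gen_eq conjgE invgK; set y := rg i s; set g := sg i.
have L : g * g * y * (g * (y * g^-1)) = g * y * g * y.
  apply: (mulIg g); rewrite !mulgA mulgVK.
  transitivity (g * (g * y * g * y)); first by rewrite !mulgA.
  by rewrite -key !mulgA.
by split; rewrite L; [rewrite -key|]; rewrite !mulgA mulgVK.
Qed.

Lemma right_gen_family : pure_family n rg.
Proof.
split=> [i r s j ir rs sj jn|i r s j ir rs sj jn|i r s ir rs sn|i r s j].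
- by apply: commute_right_gen => // k rk ks; apply: right_gen_inner; lia.
- by apply: commute_right_gen => // k rk ks; apply: right_gen_fix; lia.
- exact: right_gen_tri.
elim/ltn_pair_ind: i r / => [i|i r ir IHi] rs sj jn; last first.
  (* Conjugation by [sg i] takes [rg i.+1 s] to [rg i s] and fixes the other two generators, which
     reduces the claim to [r = i.+1]. *)
  have Ei t m : (i.+1 < t)%N -> (t < m)%N -> (m < n)%N -> rg t m ^ sg i = rg t m.
    by move=> *; apply/commute_conjg/right_gen_fix; lia.
  have [rj is_ sn] : [/\ r < j, i.+1 < s & s < n]%N by split; lia.
  rewrite -(Ei r j ir rj jn) -(Ei r s ir rs sn) (right_genS is_).
  by rewrite -conjVg -conjJg; apply/commuteJ/IHi.
(* Conjugating by [sigma_i] turns this into [A_ij ^ (A_ir A_is)^-1] commuting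
   with [A_rs], where [A_ir A_is] can be dropped. *)
suff : commute ((rg i.+1 j ^ (rg i.+1 s)^-1) ^ (sg i)^-1) (rg i s ^ (sg i)^-1).
  by move=> /(@commuteJ _ _ _ (sg i)); rewrite !conjgKV.
have [Skn Skj sn] : [/\ i.+1 < n, i.+1 < j & s < n]%N by split; lia.
have [is_ ij] : (i < s)%N /\ (i < j)%N by lia.
rewrite conjJg conjVg -(twist_right_gen Skn Skj jn) -(twist_right_gen Skn rs sn).
rewrite -(twist_right_gen Skn is_ sn).
rewrite (twist_Skl _ Skj) (twist_Skl _ rs) (twist_kl _ rs).
rewrite -conjVg -conjJg -conjgM -invgM commute_conjVl.
rewrite [X in commute _ X]commute_conjg; last first.
  by apply/cyclic3_commute/right_gen_tri.
by apply: commute_right_gen => // k rk ks; apply: right_gen_inner; lia.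
Qed.

End RightGen.

(** * Injectivity *)

Section PresentedAction.
Variables (X : choiceType) (R : seq (X * bool) -> seq (X * bool) -> Prop).
Variables (T : Type) (f g : X -> T -> T).
Hypothesis fK : forall x, cancel (f x) (g x).
Hypothesis gK : forall x, cancel (g x) (f x).

Definition word_act (u : seq (X * bool)) (t : T) : T :=
  foldr (fun l t => if l.2 then g l.1 t else f l.1 t) t u.

Lemma word_act_cat u v t : word_act (u ++ v) t = word_act u (word_act v t).
Proof. exact: foldr_cat. Qed.

Hypothesis fR : forall u v, R u v -> word_act u =1 word_act v.

Lemma word_act_eq u v : gword_eq R u v -> word_act u =1 word_act v.
Proof.
elim=> {u v} [u v /fR //|x [] t|//|u v _ uv t|u v w _ uv _ vw t|u u' v v' _ uu _ vv t].
- exact: fK.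
- exact: gK.
- by rewrite uv.
- by rewrite uv.
- by rewrite !word_act_cat vv uu.
Qed.

Definition presented_act (p : presented R) : T -> T := word_act (repr p).

Lemma presented_act_class u : presented_act (pclass R u) =1 word_act u.
Proof. by apply: word_act_eq; exact: repr_pclass. Qed.

Lemma presented_act1 t : presented_act 1 t = t.
Proof. exact: presented_act_class. Qed.

Lemma presented_actM p q t :
  presented_act (p * q) t = presented_act p (presented_act q t).
Proof.
elim/pclass_ind: p => u; elim/pclass_ind: q => v.
by rewrite [_ * _]pmulE !presented_act_class word_act_cat.
Qed.

Lemma presented_act_gen x : presented_act (pgen R x) =1 f x.
Proof. by move=> t; rewrite presented_act_class. Qed.

End PresentedAction.

(** * The homomorphism to the pure braid group, and the maps by which the braid generators will
    act *)

Section PureMap.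
Variable n : nat.
Local Notation Q := (presented (@pure_rel n)).
Local Notation sg := (sigma n).
Local Notation Ag := (Agen n).

Definition pure_right_gen (i j : nat) : pure_braid n :=
  PureBraid (right_gen_pure n i j).

Lemma pure_right_gen_family : pure_family n pure_right_gen.
Proof.
by apply: (@pure_family_morph _ _ _ (val : pure_braid n -> braid n));
  [exact: val_inj|exact: right_gen_family].
Qed.

Definition pure_map : Q -> pure_braid n :=
  plift (pure_family_respects pure_right_gen_family).
HB.instance Definition _ := UMagmaMorphism.on pure_map.

Lemma pure_map1 : pure_map 1 = 1. Proof. exact: gmulf1. Qed.

Lemma pure_mapM : {morph pure_map : p q / p * q}. Proof. exact: gmulfM. Qed.

Lemma pure_mapV : {morph pure_map : p / p^-1}. Proof. exact: gmulfV. Qed.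

Lemma pure_map_gen i j : (i < j)%N -> (j < n)%N ->
  val (pure_map (Ag i j)) = right_gen n i j.
Proof.
move=> ij jn; have ltin : (i < n)%N by lia.
by rewrite (@Agen_ord _ (Ordinal ltin) (Ordinal jn) ij) /pure_map plift_gen.
Qed.

Lemma pure_map_twist (k : 'I_n.-1) q :
  val (pure_map (twistQ k q)) = val (pure_map q) ^ (sg k)^-1.
Proof.
have kn := lt_succ_ord k.
elim/Agen_ind: q => [|i j ij jn|p q Hp Hq|p Hp].
- by rewrite twistQ1 pure_map1 conj1g.
- rewrite twistQ_gen // pure_map_gen // -twist_right_gen //.
  have M m l : (m < l)%N -> (l < n)%N -> val (pure_map (Ag m l)) = right_gen n m l.
    exact: pure_map_gen.
  (* The only increasing pair that [swapS k] reverses is [k], [k.+1], taken out by this first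
     branch. *)
  rewrite /twist; case: ifP => [_|not_k]; first exact: M.
  case: ifP => [_|_]; rewrite ?gmulfJ ?gmulfV /= !M //; rewrite /swapS;
    repeat case: eqP => ?; lia.
- by rewrite twistQM !pure_mapM !gmulfM /= Hp Hq conjMg.
- by rewrite twistQV !pure_mapV !gmulfV /= Hp conjVg.
Qed.

(** Permutations compose from left to right, so [sigma_perm k * w] exchanges the two values compared
    here. *)
Definition descent (w : 'S_n) (k : 'I_n.-1) : bool :=
  (w (strandS k) < w (strand k))%N.

Section SigmaPerm.
Variables (k : 'I_n.-1) (w : 'S_n).

Lemma sigma_perm_l : (sigma_perm k * w) (strand k) = w (strandS k).
Proof. by rewrite permM tpermL. Qed.

Lemma sigma_perm_r : (sigma_perm k * w) (strandS k) = w (strand k).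
Proof. by rewrite permM tpermR. Qed.

Lemma sigma_perm_id (x : 'I_n) : x != k :> nat -> x != k.+1 :> nat ->
  (sigma_perm k * w) x = w x.
Proof.
by move=> xk xSk; rewrite permM tpermD // eq_sym -val_eqE.
Qed.

Lemma sigma_permK : sigma_perm k * (sigma_perm k * w) = w.
Proof. by rewrite mulgA tperm2 mul1g. Qed.

Lemma descent_sigma : descent (sigma_perm k * w) k = ~~ descent w k.
Proof.
rewrite /descent sigma_perm_l sigma_perm_r -leqNgt ltn_neqAle.
suff -> : w (strand k) != w (strandS k) :> nat by [].
by rewrite (inj_eq val_inj) (inj_eq perm_inj) -val_eqE /= neq_ltn ltnSn.
Qed.

End SigmaPerm.

Definition lmul (q : Q) (e : Q * 'S_n) : Q * 'S_n := (q * e.1, e.2).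

Lemma lmulA p q e : lmul p (lmul q e) = lmul (p * q) e.
Proof. by rewrite /lmul mulgA. Qed.

(** Moving [sigma_k] past [q] twists [q]. At a descent the permutation braid of [w] begins with
    [sigma_k], and the resulting square is the extra [Ag k k.+1]. *)
Definition sigma_act (k : 'I_n.-1) (e : Q * 'S_n) : Q * 'S_n :=
  (twistQ k e.1 * (if descent e.2 k then Ag k k.+1 else 1), sigma_perm k * e.2).

Lemma sigma_act_lmul k q e :
  sigma_act k (lmul q e) = lmul (twistQ k q) (sigma_act k e).
Proof. by rewrite /sigma_act /lmul /= twistQM mulgA. Qed.

(** Exactly one of the two steps is at a descent; the conjugation in [twistQ_sqr] moves its factor
    to the left of [q]. *)
Lemma sigma_act_sqr k e : sigma_act k (sigma_act k e) = lmul (Ag k k.+1) e.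
Proof.
case: e => q w; rewrite /sigma_act /lmul /= sigma_permK descent_sigma twistQM.
congr pair; rewrite twistQ_sqr conjgE invgK.
by case: descent => /=;
  rewrite ?(twistQ_eq (erefl (k : nat))) ?twistQ1 ?mulg1 !mulgA mulgVK.
Qed.

(** Models [sigma_k^-1 = sigma_k * A_{k,k+1}^-1]. *)
Definition sigma_actV k e := sigma_act k (lmul (Ag k k.+1)^-1 e).

Lemma sigma_actVK k : cancel (sigma_actV k) (sigma_act k).
Proof. by move=> [q w]; rewrite sigma_act_sqr /lmul /= mulVKg. Qed.

Lemma sigma_actK k : cancel (sigma_act k) (sigma_actV k).
Proof.
move=> [q w]; rewrite /sigma_actV sigma_act_lmul sigma_act_sqr.
by rewrite twistQV twistQ_eq // /lmul /= mulKg.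
Qed.

End PureMap.

(** * The action of the braid group on pairs *)

Section BraidAction.
Variable n : nat.
Local Notation Q := (presented (@pure_rel n)).
Local Notation sg := (sigma n).
Local Notation Ag := (Agen n).

Lemma sigma_perm_far (k l : 'I_n.-1) : (k.+1 < l)%N ->
  sigma_perm k * sigma_perm l = sigma_perm l * sigma_perm k.
Proof.
move=> kl; have R : @braid_rel n [:: ltr k; ltr l] [:: ltr l; ltr k].
  by apply: braid_far; rewrite kl.
by have := sigma_perm_rel R; rewrite /gword_eval !big_cons big_nil /= !mulg1.
Qed.

Lemma sigma_perm_adj (k l : 'I_n.-1) : l = k.+1 :> nat ->
  sigma_perm k * (sigma_perm l * sigma_perm k) =
  sigma_perm l * (sigma_perm k * sigma_perm l).
Proof.
move=> kl; have := sigma_perm_rel (braid_adj kl).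
by rewrite /gword_eval !big_cons big_nil /= !mulg1.
Qed.

Lemma descent_far (k l : 'I_n.-1) w : (k.+1 < l)%N || (l.+1 < k)%N ->
  descent (sigma_perm l * w) k = descent w k.
Proof. by move=> kl; rewrite /descent !sigma_perm_id //=; lia. Qed.

Section DescentAdj.
Variables (k l : 'I_n.-1) (w : 'S_n).
Hypothesis kl : l = k.+1 :> nat.

Let strand_l : strand l = strandS k. Proof. exact: val_inj. Qed.

Let w_k (v : 'S_n) : (sigma_perm k * v) (strandS l) = v (strandS l).
Proof. by rewrite sigma_perm_id //=; lia. Qed.

Let w_l (v : 'S_n) : (sigma_perm l * v) (strand k) = v (strand k).
Proof. by rewrite sigma_perm_id //=; lia. Qed.

Lemma descent_adj_kl : descent (sigma_perm k * w) l = descent (sigma_perm l * w) k.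
Proof.
by rewrite /descent w_k w_l -strand_l sigma_perm_l strand_l sigma_perm_r.
Qed.

Lemma descent_adj_lk :
  descent (sigma_perm l * (sigma_perm k * w)) k = descent w l.
Proof.
by rewrite /descent w_l sigma_perm_l -strand_l sigma_perm_l w_k.
Qed.

Lemma descent_adj_kll :
  descent (sigma_perm k * (sigma_perm l * w)) l = descent w k.
Proof.
by rewrite /descent w_k sigma_perm_r strand_l sigma_perm_r w_l.
Qed.

(** Equal answers at [k] and [l] make [w] monotone on three consecutive positions, which decides the
    comparison of the outer two. *)
Lemma descent_adj_both : descent w k = descent w l ->
  descent (sigma_perm k * w) l = descent w k.
Proof.
rewrite /descent w_k strand_l sigma_perm_r.
have : w (strandS k) != w (strand k) :> nat.
  by rewrite (inj_eq val_inj) (inj_eq perm_inj) -val_eqE /=; lia.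
have : w (strandS k) != w (strandS l) :> nat.
  by rewrite (inj_eq val_inj) (inj_eq perm_inj) -val_eqE /=; lia.
lia.
Qed.

End DescentAdj.

Lemma sigma_act_far (k l : 'I_n.-1) e : (k.+1 < l)%N ->
  sigma_act k (sigma_act l e) = sigma_act l (sigma_act k e).
Proof.
move=> kl; have [kn ln] := (lt_succ_ord k, lt_succ_ord l).
case: e => q w; rewrite /sigma_act /=; congr pair; last first.
  by rewrite !mulgA sigma_perm_far.
rewrite !descent_far ?kl ?orbT // !twistQM twistQ_far // -!mulgA.
congr (_ * _).
have ck : twistQ l (Ag k k.+1) = Ag k k.+1 by rewrite twistQ_id //; lia.
have cl : twistQ k (Ag l l.+1) = Ag l l.+1 by rewrite twistQ_id //; lia.
case: (descent w k) (descent w l) => -[];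
  rewrite ?twistQ1 ?mulg1 ?mul1g ?ck ?cl //.
by apply: commute_sym; apply: (pf_disj (Agen_family n)).
Qed.

Lemma sigma_act_adj (k l : 'I_n.-1) e : l = k.+1 :> nat ->
  sigma_act k (sigma_act l (sigma_act k e)) =
  sigma_act l (sigma_act k (sigma_act l e)).
Proof.
move=> kl; have [kn ln] := (lt_succ_ord k, lt_succ_ord l).
case: e => q w; rewrite /sigma_act /=; congr pair; last first.
  by have := congr1 (mulg^~ w) (sigma_perm_adj kl); rewrite -!mulgA.
(* The two sides meet the same three descent conditions, in opposite orders. *)
rewrite (descent_adj_lk w kl) (descent_adj_kll w kl) -(descent_adj_kl w kl).
rewrite !twistQM (twistQ_adj kl) -!mulgA; congr (_ * _).
rewrite kl in ln *.
have ccl : twistQ l (Ag k k.+1) = Ag k k.+2 by rewrite twistQ_kr.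
have ckl : twistQ k (Ag k.+1 k.+2) = Ag k k.+2 ^ (Ag k k.+1)^-1.
  by rewrite twistQ_Skl.
have clk : twistQ k (Ag k k.+2) = Ag k.+1 k.+2 by rewrite twistQ_kl.
have cll : twistQ l (Ag k k.+2) = Ag k k.+1 ^ (Ag k.+1 k.+2)^-1.
  by rewrite twistQ_Skr.
have fixk : twistQ l (twistQ k (Ag k.+1 k.+2)) = Ag k k.+1.
  by rewrite ckl twistQJ twistQV ccl cll (twistQ_adj_fix kl).
have [e1 e2] : cyclic3 (Ag k k.+1) (Ag k k.+2) (Ag k.+1 k.+2).
  by apply: (pf_tri (Agen_family n)).
(* Six sign patterns survive, one for each relative order of the values of [w] at [k], [k.+1],
   [k.+2]. *)
have := @descent_adj_both k l w kl.
case: (descent w k) (descent w l) (descent (sigma_perm k * w) l) => -[] [] //=;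
  try by move=> /(_ erefl).
all: move=> _; rewrite ?twistQ1 ?mulg1 ?mul1g ?fixk ?ccl ?clk ?ckl //.
- by rewrite -conjgCV !mulgA.
- by rewrite conjgE invgK !mulgA e2 e1 mulgK.
- by rewrite -conjgCV.
Qed.

Lemma sigma_act_rel u v : @braid_rel n u v ->
  word_act (@sigma_act n) (@sigma_actV n) u =1 word_act (@sigma_act n) (@sigma_actV n) v.
Proof.
case=> {u v} i j ij e /=; last exact: sigma_act_adj.
by case/orP: ij => ij; rewrite (sigma_act_far _ ij).
Qed.

Definition braid_act : braid n -> Q * 'S_n -> Q * 'S_n :=
  presented_act (R := @braid_rel n) (@sigma_act n) (@sigma_actV n).

Lemma braid_actM a b e : braid_act (a * b) e = braid_act a (braid_act b e).
Proof.
exact: (presented_actM (@sigma_actK n) (@sigma_actVK n) sigma_act_rel).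
Qed.

Lemma braid_act1 e : braid_act 1 e = e.
Proof.
exact: (presented_act1 (@sigma_actK n) (@sigma_actVK n) sigma_act_rel).
Qed.

Lemma braid_actK a : cancel (braid_act a) (braid_act a^-1).
Proof. by move=> e; rewrite -braid_actM mulVg braid_act1. Qed.

Lemma braid_act_sigma (k : 'I_n.-1) e : braid_act (sg k) e = sigma_act k e.
Proof.
rewrite sigmaE.
exact: (presented_act_gen (@sigma_actK n) (@sigma_actVK n) sigma_act_rel).
Qed.

(** By [sigma_act_lmul], conjugating by [sg i] corresponds to [twistQ], which takes [Ag i j] to
    [Ag i.+1 j]; this matches [right_genS]. *)
Lemma braid_act_right_gen i j e : (i < j)%N -> (j < n)%N ->
  braid_act (right_gen n i j) e = lmul (Ag i j) e.
Proof.
move=> ij; elim/ltn_pair_ind: i j / ij e => [i|i j ij IHi] e jn.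
  have ltin : (i < n.-1)%N by lia.
  rewrite right_gen_eq braid_actM -[i]/(val (Ordinal ltin)) !braid_act_sigma.
  exact: sigma_act_sqr.
have ltin : (i < n.-1)%N by lia.
rewrite (right_genS _ ij) conjgE (braid_actM (sg i)^-1) (braid_actM (right_gen n i.+1 j)).
rewrite IHi //.
apply: (can_inj (braid_actK (sg i))).
rewrite -[LHS]braid_actM mulgV braid_act1.
rewrite -[sg i]/(sg (val (Ordinal ltin))) !braid_act_sigma sigma_act_lmul.
by rewrite twistQ_kl.
Qed.

Lemma braid_act_pure_map q e : braid_act (val (pure_map q)) e = lmul q e.
Proof.
elim/Agen_ind: q e => [|i j ij jn|p q Hp Hq|p Hp] e.
- by rewrite pure_map1 braid_act1 /lmul mul1g -surjective_pairing.
- by rewrite pure_map_gen // braid_act_right_gen.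
- by rewrite pure_mapM gmulfM braid_actM Hq Hp lmulA.
- rewrite pure_mapV gmulfV /=.
  apply: (can_inj (braid_actK (val (pure_map p)))).
  rewrite -[LHS]braid_actM mulgV braid_act1 Hp lmulA mulgV.
  by rewrite /lmul mul1g -surjective_pairing.
Qed.

Lemma pure_map_inj : injective (@pure_map n).
Proof.
move=> p q pq; have := braid_act_pure_map p (1, 1).
by rewrite pq braid_act_pure_map /lmul !mulg1 => -[].
Qed.

End BraidAction.

(** * Surjectivity *)

Section PermutationBraid.
Variable n : nat.
Local Notation Q := (presented (@pure_rel n)).
Local Notation sg := (sigma n).
Local Notation Ag := (Agen n).

(** A termination measure: coefficients of neighbouring positions differ by 1, so undoing a descent
    lowers the sum by the difference of the exchanged values. *)
Definition weight (w : 'S_n) : nat := \sum_(x < n) (n - x) * w x.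

Lemma weight_descent w k : descent w k -> (weight (sigma_perm k * w) < weight w)%N.
Proof.
move=> dk; have ne : strandS k != strand k by rewrite -val_eqE /=; lia.
have kn := lt_succ_ord k.
have E v : weight v = (n - k) * v (strand k) + (n - k.+1) * v (strandS k) +
    \sum_(x < n | (x != strand k) && (x != strandS k)) (n - x) * v x.
  by rewrite /weight (bigD1 (strand k)) //= (bigD1 (strandS k)) //= addnA.
rewrite !E sigma_perm_l sigma_perm_r.
rewrite [X in (_ + X < _)%N](eq_bigr (fun x : 'I_n => (n - x) * w x)%N); last first.
  by move=> x /andP[xk xSk]; rewrite sigma_perm_id.
rewrite ltn_add2r; rewrite /descent in dk.
have [m Em] : exists m, (n - k = m.+2)%N by exists (n - k - 2)%N; lia.
have -> : (n - k.+1 = m.+1)%N by lia.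
rewrite Em; nia.
Qed.

(** Here [m] is fuel; by [perm_braid_rec_eq], any amount from [weight w] on gives the same braid. *)
Fixpoint perm_braid_rec (m : nat) (w : 'S_n) : braid n :=
  if m is m'.+1 then
    if [pick k | descent w k] is Some k then
      sg k * perm_braid_rec m' (sigma_perm k * w)
    else 1
  else 1.

(* The positive permutation braid of [w]. *)
Definition perm_braid (w : 'S_n) : braid n := perm_braid_rec (weight w) w.

Lemma perm_braid_rec_eq m m' w : (weight w <= m)%N -> (weight w <= m')%N ->
  perm_braid_rec m w = perm_braid_rec m' w.
Proof.
elim: m m' w => [|m IHm] [|m'] w //= wm wm'.
- case: pickP => // k /weight_descent; lia.
- case: pickP => // k /weight_descent; lia.
- case: pickP => // k /weight_descent dk; congr (_ * _); apply: IHm; lia.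
Qed.

Lemma perm_braidE w : perm_braid w =
  if [pick k | descent w k] is Some k then sg k * perm_braid (sigma_perm k * w)
  else 1.
Proof.
rewrite {1}/perm_braid; case Ew : (weight w) => [|m] /=.
  by case: pickP => // k /weight_descent; rewrite Ew.
case: pickP => // k /weight_descent dk; congr (_ * _).
by apply: perm_braid_rec_eq => //; lia.
Qed.

Lemma perm_braid1 : perm_braid 1 = 1.
Proof.
rewrite perm_braidE; case: pickP => // k.
by rewrite /descent !perm1 /= ltnNge leqnSn.
Qed.

(* [w] has a reduced word beginning with the longest element of the subgroup
   generated by [s_k] and [s_l]; both sides peel that element off [w]. *)
Lemma perm_braid_confluent w (k l : 'I_n.-1) : (k < l)%N ->
  descent w k -> descent w l ->
  (forall v i, (weight v < weight w)%N -> descent v i ->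
     perm_braid v = sg i * perm_braid (sigma_perm i * v)) ->
  sg k * perm_braid (sigma_perm k * w) = sg l * perm_braid (sigma_perm l * w).
Proof.
move=> ltkl dk dl IH; have [kn ln] := (lt_succ_ord k, lt_succ_ord l).
have [wk wl] := (weight_descent dk, weight_descent dl).
have [kl|kl] := eqVneq (l : nat) k.+1.
  have d_kl : descent (sigma_perm k * w) l.
    by rewrite (descent_adj_both kl) // dk dl.
  have d_lk : descent (sigma_perm l * w) k by rewrite -(descent_adj_kl w kl).
  have [wkl wlk] := (weight_descent d_kl, weight_descent d_lk).
  rewrite (IH _ _ wk d_kl) (IH _ _ wl d_lk).
  rewrite (IH _ k (ltn_trans wkl wk)) ?(descent_adj_lk w kl) //.
  rewrite (IH _ l (ltn_trans wlk wl)) ?(descent_adj_kll w kl) //.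
  have -> : sigma_perm k * (sigma_perm l * (sigma_perm k * w)) =
      sigma_perm l * (sigma_perm k * (sigma_perm l * w)).
    by have := congr1 (mulg^~ w) (sigma_perm_adj kl); rewrite -!mulgA.
  by rewrite !mulgA kl sigma_adj // -kl.
have {}kl : (k.+1 < l)%N by lia.
rewrite (IH _ l wk) ?descent_far ?kl ?orbT // (IH _ k wl) ?descent_far ?kl //.
by rewrite !mulgA (sigma_perm_far kl) (@sigma_far n k l kl).
Qed.

(** The braid does not depend on the descent that [pick] returns: by induction on the weight,
    [perm_braid_confluent] compares any two choices. *)
Lemma perm_braid_descent w k : descent w k ->
  perm_braid w = sg k * perm_braid (sigma_perm k * w).
Proof.
have [m] := ubnP (weight w); elim: m w k => // m IHm w k wm dk.
have IH v i : (weight v < weight w)%N -> descent v i ->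
    perm_braid v = sg i * perm_braid (sigma_perm i * v).
  by move=> vw; apply: IHm; apply: leq_trans vw _.
rewrite perm_braidE; case: pickP => [i di|/(_ k)]; last by rewrite dk.
have [ltik|ltki|/val_inj-> //] := ltngtP i k; first exact: perm_braid_confluent.
by symmetry; apply: perm_braid_confluent.
Qed.

Lemma sigma_perm_braid w (k : 'I_n.-1) : exists q,
  sg k * perm_braid w = val (pure_map q) * perm_braid (sigma_perm k * w).
Proof.
have [dk|ndk] := boolP (descent w k); last first.
  exists 1; rewrite pure_map1 gmulf1 mul1g (@perm_braid_descent (_ * w) k).
    by rewrite sigma_permK.
  by rewrite descent_sigma.
have kn := lt_succ_ord k.
exists (Ag k k.+1); rewrite (perm_braid_descent dk) pure_map_gen //.
by rewrite right_gen_eq mulgA.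
Qed.

Lemma braid_perm_sigma (k : 'I_n.-1) : braid_perm (sg k) = sigma_perm k.
Proof. by rewrite sigmaE /braid_perm plift_gen. Qed.

Lemma braid_decomposition (b : braid n) :
  exists q, b = val (pure_map q) * perm_braid (braid_perm b).
Proof.
have sigma_step (k : 'I_n.-1) (c : braid n) :
    (exists q, c = val (pure_map q) * perm_braid (braid_perm c)) ->
  exists q, sg k * c = val (pure_map q) * perm_braid (braid_perm (sg k * c)).
  case=> q Ec; have [q' Eq'] := sigma_perm_braid (braid_perm c) k.
  (* The first factor comes from moving [sg k] past [q], the second from its product with the
     permutation braid. *)
  exists (twistQ k q * q'); rewrite pure_mapM gmulfM /= pure_map_twist.
  rewrite braid_permM braid_perm_sigma -mulgA -Eq' [in LHS]Ec conjgE invgK.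
  by rewrite !mulgA mulgVK.
elim/pclass_ind: b => u; elim: u => [|[x b] u IHu].
  by exists 1; rewrite pure_map1 gmulf1 mul1g braid_perm1 perm_braid1.
rewrite -[(x, b) :: u]/([:: (x, b)] ++ u) -pmulE.
case: b; last by have := sigma_step x _ IHu; rewrite sigmaE.
have -> : pclass (@braid_rel n) [:: (x, true)] = (sg x)^-1.
  by rewrite sigmaE [RHS]pinvE.
have xn := lt_succ_ord x.
have [q Eq] := sigma_step x _ IHu.
(* An inverse letter is a positive one up to a pure factor, and the two have the same
   permutation. *)
have Ex : (sg x)^-1 = val (pure_map (Ag x x.+1)^-1) * sg x.
  by rewrite pure_mapV gmulfV /= pure_map_gen // right_gen_eq invgM mulgVK.
exists ((Ag x x.+1)^-1 * q); rewrite pure_mapM gmulfM /=.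
rewrite -[LHS]/((sg x)^-1 * _) braid_permM braid_permV.
have -> : (braid_perm (sg x))^-1 = braid_perm (sg x).
  by rewrite braid_perm_sigma tpermV.
by rewrite -braid_permM -mulgA -Eq mulgA -Ex.
Qed.

Lemma pure_map_surj b : exists q, pure_map q = b :> pure_braid n.
Proof.
have [q Eb] := braid_decomposition (val b); exists q; apply: val_inj.
by rewrite Eb (pure_predP _ (valP b)) perm_braid1 mulg1.
Qed.

End PermutationBraid.

Theorem proposition2p2 (n : nat) (hn : (1 <= n)%N) :
  @is_presentation (pure_braid n) (pure_index n) (@pure_gen n) (@pure_rel n).
Proof.
exists (@pure_map n); split=> [x|]; first exact: plift_gen.
have [g gK] := choice (@pure_map_surj n).
by exists g => // q; apply: (@pure_map_inj n); rewrite gK.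
Qed.
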